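(* Let $X$ and $Y$ be Banach spaces. If $X$ is reflexive and $(X,Y)$ has property strict $(M)$, then $(X,Y)$ has the weak maximizing property (WMP).
   Context: The scalar field is $\mathbb{R}$ or $\mathbb{C}$; $\mathcal{L}(X,Y)$ is the Banach space of bounded linear operators; $B_X$, $S_X$ are the closed unit ball and unit sphere. A contraction is an operator of norm at most $1$. A contraction $T\in\mathcal{L}(X,Y)$ has property strict $(M)$ if whenever $x\in X$ and $y\in Y$ satisfy $\|y\|<\|x\|$, then $\limsup_n\|y+Tx_n\|<\limsup_n\|x+x_n\|$ for every weakly null sequence $(x_n)\subset X$. The pair $(X,Y)$ has property strict $(M)$ if every contraction in $\mathcal{L}(X,Y)$ has property strict $(M)$. An operator $T\in\mathcal{L}(X,Y)$ attains its norm if $\|Tx\|=\|T\|$ for some $x\in S_X$. A maximizing sequence of $T$ is a sequence $(x_n)\subset B_X$ with $\lim_n\|Tx_n\|=\|T\|$. The pair $(X,Y)$ has the WMP if every $T\in\mathcal{L}(X,Y)$ having a maximizing sequence that is not weakly null attains its norm. *)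

(* Defs.v *)
From mathcomp Require Import all_boot all_order all_algebra.
From mathcomp Require Import all_classical all_reals.
From mathcomp Require Import topology normedtype sequences.
From mathcomp Require Import complex.


Import Order.TTheory GRing.Theory Num.Theory.
Import numFieldNormedType.Exports.

Local Open Scope classical_set_scope.
Local Open Scope ring_scope.

Variant scalars := RealScalars | ComplexScalars.

Definition scalar_field (R : realType) (s : scalars) : numFieldType :=
  match s with RealScalars => R | ComplexScalars => R[i] end.

Definition real_part {R : realType} {s : scalars} : scalar_field R s -> R :=
  match s return scalar_field R s -> R with
  | RealScalars => fun x : R => x
  | ComplexScalars => fun z : R[i] => complex.Re z
  end.

Section defs.
Context {R : realType} {s : scalars}.
Local Notation K := (scalar_field R s).

(* MathComp norms take their values in the scalar field, here R or R[i]; they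
   are brought back to R so that sup and limsup make sense. *)
Definition rnorm {V : normedModType K} (v : V) : R := real_part `|v|.

(* The space L(X,Y), as a set of functions; functions X -> Y carry the pointwise
   lmodType structure. *)
Definition bounded_operators (X Y : normedModType K) : set (X -> Y) :=
  [set T | linear T /\ exists M : R, forall x, rnorm (T x) <= M * rnorm x].

(* Only meaningful on bounded operators: sup is 0 on unbounded sets. *)
Definition opnorm {X Y : normedModType K} (T : X -> Y) : R :=
  sup [set rnorm (T x) | x in [set x : X | rnorm x <= 1]].

Definition dual (X : normedModType K) : set (X -> K^o) :=
  bounded_operators X K^o.

(* A functional on X^* is represented by a function on all of X -> K^o, of which
   only the values on dual X matter. *)
Definition bidual (X : normedModType K) : set ((X -> K^o) -> K^o) :=
  [set phi |
    (forall (a : K) (f g : X -> K^o), dual X f -> dual X g ->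
       phi (a *: f + g) = a *: phi f + phi g) /\
    exists M : R, forall f, dual X f -> rnorm (phi f) <= M * opnorm f].

(* The canonical embedding of X into its bidual is onto. *)
Definition reflexive_space (X : normedModType K) : Prop :=
  forall phi, bidual X phi -> exists x : X, forall f, dual X f -> phi f = f x.

Definition weakly_null {X : normedModType K} (u : nat -> X) : Prop :=
  forall f, dual X f -> f (u n) @[n --> \oo] --> (0 : K^o).

Definition op_contraction {X Y : normedModType K} (T : X -> Y) : Prop :=
  bounded_operators X Y T /\ opnorm T <= 1.

(* The limsups are taken in \bar R; they are finite here, weakly null sequences
   being bounded. *)
Definition op_strictM {X Y : normedModType K} (T : X -> Y) : Prop :=
  forall (x : X) (y : Y), rnorm y < rnorm x ->
  forall u : nat -> X, weakly_null u ->
    (limn_esup (fun n => (rnorm (y + T (u n)))%:E) <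
     limn_esup (fun n => (rnorm (x + u n))%:E))%E.

Definition pair_strictM (X Y : normedModType K) : Prop :=
  forall T : X -> Y, op_contraction T -> op_strictM T.

Definition attains_norm {X Y : normedModType K} (T : X -> Y) : Prop :=
  exists2 x : X, rnorm x = 1 & rnorm (T x) = opnorm T.

Definition maximizing_sequence {X Y : normedModType K} (T : X -> Y)
    (u : nat -> X) : Prop :=
  (forall n, rnorm (u n) <= 1) /\ rnorm (T (u n)) @[n --> \oo] --> opnorm T.

Definition pair_WMP (X Y : normedModType K) : Prop :=
  forall T : X -> Y, bounded_operators X Y T ->
  (exists2 u, maximizing_sequence T u & ~ weakly_null u) -> attains_norm T.

End defs.

(* Main.v *)
Require Import Defs.
From HB Require Import structures.
From mathcomp Require Import all_boot all_order all_algebra.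
From mathcomp Require Import all_classical all_reals interval_inference.
From mathcomp Require Import ereal topology normedtype sequences.
From mathcomp Require Import complex.
From mathcomp Require Import ring lra.

(** Normalise [T] to have norm [1]. A maximizing sequence that is not weakly null has a
    subsequence on which some functional stays away from [0]; since [X] is reflexive, this
    subsequence may be taken to converge weakly, to some [x], and then [x != 0]. If [T] did not
    attain its norm we would have [|T x| < |x|], and property strict (M), applied to [x], to [T x]
    and to the weakly null sequence [u n - x], would give
    [1 = limsup |T (u n)| < limsup |u n| <= 1]. So [|T x| >= |x|] and [T] attains its norm at
    [x / |x|]; this last argument is [weak_limit_maximizing].

    The substance lies in [reflexive_weak_subsequence]: with reflexivity meaning that the
    canonical embedding into the bidual is onto, bounded sequences have weakly convergent
    subsequences. Along an ultrafilter every bounded family [u] has a weak limit, because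
    [f |-> lim f (u n)] belongs to the bidual ([reflexive_ultralimit]). To get from the ultrafilter
    to a subsequence, choose for each vector [d] of the countable rational span of [u] a functional
    norming [d], and then a subsequence on which these countably many functionals converge to
    their values at the ultrafilter limit [x]. Any other ultrafilter limit [y] of the subsequence,
    or of a further one, takes the same values. As [x] and [y] lie in the closed span of [u]
    ([weak_limit_dist0]), where the chosen functionals separate points ([eq0_of_norming]),
    [y = x]. With a single possible ultrafilter limit, the subsequence converges weakly to [x].

    The norming functionals and the weak closedness of the span both come from the Hahn-Banach
    theorem, in the form: a seminorm [p] below the norm has, at each point [x0], a functional whose
    real part is below [p] and agrees with it at [x0] ([supporting_functional]). Hahn-Banach is
    proved for real vector spaces; a complex space is viewed as a real one ([realified]), and a
    complex functional is recovered from its real part ([dual_of_real_linear]). *)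

Set Implicit Arguments.
Unset Strict Implicit.
Unset Printing Implicit Defensive.

Import Order.TTheory GRing.Theory Num.Theory.
Import numFieldNormedType.Exports.

Local Open Scope classical_set_scope.
Local Open Scope ring_scope.

(** * The Hahn-Banach theorem *)

Section HahnBanach.
Context {R : realType} {V : lmodType R}.

Definition sublinear (p : V -> R) : Prop :=
  (forall x y, p (x + y) <= p x + p y) /\
  (forall t x, 0 <= t -> p (t *: x) = t * p x).

(** Graphs of linear functionals on subspaces of [V], dominated by [p] and supporting it at [x0].
    Single-valuedness is not imposed because it follows from domination. The empty graph is
    admitted, so that the union of an empty chain is still in the family. *)
Definition dominated_graph (p : V -> R) (x0 : V) (G : set (V * R)) : Prop :=
  [/\ forall t a b, G a -> G b -> G (t *: a.1 + b.1, t * a.2 + b.2),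
      forall a, G a -> a.2 <= p a.1 &
      G !=set0 -> G (x0, p x0)].

(** With [r], also [- r] is a value at [0], and both are at most [p 0 = 0]. *)
Lemma dominated_graph0 p x0 G r : sublinear p -> dominated_graph p x0 G ->
  G (0, r) -> r = 0.
Proof.
move=> [_ ph] [Gl Gd _] G0.
have p0 : p 0 = 0 by rewrite -[X in p X](scale0r (0 : V)) ph ?mul0r.
have := Gl (-2) _ _ G0 G0; rewrite /= scaler0 addr0 => /Gd /=; rewrite p0.
by have /= := Gd _ G0; rewrite p0; lra.
Qed.

Lemma dominated_graph_fun p x0 G x r s : sublinear p -> dominated_graph p x0 G ->
  G (x, r) -> G (x, s) -> r = s.
Proof.
move=> ps pG Gr Gs; have [Gl _ _] := pG.
have := Gl (-1) _ _ Gr Gs; rewrite /= scaleN1r addNr.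
by move=> /(dominated_graph0 ps pG); lra.
Qed.

Lemma dominated_graph_line p x0 : sublinear p ->
  dominated_graph p x0 [set (t *: x0, t * p x0) | t in setT].
Proof.
move=> [pD pZ].
have p0 : p 0 = 0 by rewrite -[X in p X](scale0r (0 : V)) pZ ?mul0r.
have pN : 0 <= p x0 + p (- x0) by rewrite -p0 -(subrr x0) pD.
split.
- move=> t _ _ [a _ <-] [b _ <-]; exists (t * a + b) => //=.
  by rewrite scalerDl scalerA mulrDl mulrA.
- move=> _ [t _ <-] /=; have [t0|t0] := leP 0 t; first by rewrite pZ.
  have -> : t *: x0 = (- t) *: (- x0) by rewrite scaleNr scalerN opprK.
  rewrite pZ; last by rewrite oppr_ge0 ltW.
  rewrite -subr_ge0.
  have -> : - t * p (- x0) - t * p x0 = - t * (p x0 + p (- x0)) by ring.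
  by rewrite mulr_ge0// oppr_ge0 ltW.
- by move=> _; exists 1 => //; rewrite scale1r mul1r.
Qed.

(** One-step extension to [v]: subadditivity of [p] puts every [a.2 - p (a.1 - v)] below every
    [p (b.1 + v) - b.2], and any value [c] at [v] between the two families keeps the extension
    dominated. *)
Lemma dominated_graph_extend p x0 G v : sublinear p -> dominated_graph p x0 G ->
  G !=set0 -> exists c, dominated_graph p x0
    [set (a.1 + t *: v, a.2 + t * c) | a in G & t in setT].
Proof.
move=> [pD pZ] [Gl Gd Gx0] G0.
pose B := [set a.2 - p (a.1 - v) | a in G].
have key a b : G a -> G b -> a.2 - p (a.1 - v) <= p (b.1 + v) - b.2.
  move=> Ga Gb; have := Gl 1 _ _ Ga Gb => /Gd /=; rewrite scale1r mul1r.
  by have := pD (a.1 - v) (b.1 + v); rewrite addrACA addNr addr0; lra.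
have Bs : has_sup B.
  have [a Ga] := G0; split; first by exists (a.2 - p (a.1 - v)); exists a.
  by exists (p (a.1 + v) - a.2) => _ [b Gb <-]; exact: key.
exists (sup B); split.
- move=> t _ _ [a Ga [r _ <-]] [b Gb [s _ <-]] /=.
  exists (t *: a.1 + b.1, t * a.2 + b.2); first exact: Gl.
  exists (t * r + s) => //=; congr (_, _); last by ring.
  by rewrite scalerDr scalerA [in RHS]addrACA scalerDl.
- move=> _ [a Ga [t _ <-]] /=.
  have Z0 : G (0, 0).
    have := Gl (-1) _ _ Ga Ga.
    by rewrite scaleN1r addNr mulN1r addNr.
  have GZ r : G (r *: a.1, r * a.2).
    by have := Gl r _ _ Ga Z0; rewrite /= !addr0.
  have [t0|t0|->] := ltgtP t 0; last by rewrite scale0r mul0r !addr0; exact: Gd.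
  + have t1 : 0 < - t by rewrite oppr_gt0.
    have : sup B >= (- t)^-1 * a.2 - p ((- t)^-1 *: a.1 - v).
      by apply: ub_le_sup; [exact: (Bs.2)|exists ((- t)^-1 *: a.1, (- t)^-1 * a.2)].
    have -> : a.1 + t *: v = (- t) *: ((- t)^-1 *: a.1 - v).
      by rewrite scalerBr scalerA mulfV ?gt_eqF// scale1r scaleNr opprK.
    rewrite pZ; last exact: ltW.
    rewrite -(ler_pM2l t1) mulrBr mulrA mulfV ?gt_eqF// mul1r.
    by lra.
  + have : sup B <= p (t^-1 *: a.1 + v) - t^-1 * a.2.
      apply: ge_sup; first exact: Bs.1.
      by move=> _ [b Gb <-]; exact: (key b _ Gb (GZ t^-1)).
    have -> : a.1 + t *: v = t *: (t^-1 *: a.1 + v).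
      by rewrite scalerDr scalerA mulfV ?gt_eqF// scale1r.
    rewrite pZ; last exact: ltW.
    rewrite -(ler_pM2l t0) mulrBr mulrA mulfV ?gt_eqF// mul1r.
    by lra.
- move=> _; exists (x0, p x0); first exact: Gx0.
  by exists 0 => //=; rewrite scale0r mul0r !addr0.
Qed.

(** A maximal dominated graph is nonempty, as it could otherwise be enlarged to the line through
    [x0], and it is total, as it could otherwise be extended by one vector. *)
Lemma hahn_banach (p : V -> R) (x0 : V) : sublinear p ->
  exists h : V -> R, [/\ forall t x y, h (t *: x + y) = t * h x + h y,
    forall x, h x <= p x & h x0 = p x0].
Proof.
move=> ps.
have [F FP Ftot|G [pG Gmax]] := @Zorn_bigcup _ (dominated_graph p x0).
  split.
  - move=> t a b [A FA Aa] [B FB Bb].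
    have [AB|BA] := Ftot _ _ FA FB.
      by exists B => //; have [Bl _ _] := FP _ FB; apply: Bl => //; exact: AB.
    by exists A => //; have [Al _ _] := FP _ FA; apply: Al => //; exact: BA.
  - by move=> a [A FA Aa]; have [_ + _] := FP _ FA; exact.
  - move=> [a [A FA Aa]]; exists A => //; have [_ _] := FP _ FA.
    by apply; exists a.
have [Gl Gd Gx0] := pG.
have G0 : G !=set0.
  apply/set0P/eqP => G0; apply: (Gmax _ _ (dominated_graph_line x0 ps)).
  rewrite G0; split; first exact: sub0set.
  by move=> /(_ (1 *: x0, 1 * p x0)); apply; exists 1.
have Gtot x : exists r, G (x, r).
  apply: contrapT => Gx; have [c cG] := dominated_graph_extend x ps pG G0.
  apply: (Gmax _ _ cG); split.
    by move=> -[v r] Gvr; exists (v, r) => //; exists 0; rewrite //= scale0r mul0r !addr0.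
  move=> sG; apply: Gx.
  have [a Ga] := G0.
  have Z0 : G (0, 0) by have := Gl (-1) _ _ Ga Ga; rewrite scaleN1r addNr mulN1r addNr.
  exists c; apply: sG; exists (0, 0) => //; exists 1 => //=.
  by rewrite !add0r scale1r mul1r.
have [h Gh] := choice Gtot.
exists h; split => [t x y|x|].
- by apply: dominated_graph_fun ps pG (Gh _) _; exact: (Gl t _ _ (Gh x) (Gh y)).
- exact: (Gd _ (Gh x)).
- exact: dominated_graph_fun ps pG (Gh _) (Gx0 G0).
Qed.

End HahnBanach.

(** * The distance to a rational span *)

Section RationalSpan.
Context {R : realType} {V : lmodType R}.

Definition seminorm (N : V -> R) : Prop :=
  (forall x y, N (x + y) <= N x + N y) /\ (forall t x, N (t *: x) = `|t| * N x).

(** Stability under rational scalars only: this leaves room for countable dense subsets. *)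
Definition rational_subspace (D : set V) : Prop :=
  D 0 /\ forall (q : rat) x y, D x -> D y -> D (ratr q *: x + y).

Definition dist_to (N : V -> R) (D : set V) (x : V) : R := inf [set N (x - d) | d in D].

Section distance.
Context (N : V -> R) (D : set V).
Hypotheses (Nseminorm : seminorm N) (Dsub : rational_subspace D).

Lemma seminormN x : N (- x) = N x.
Proof. by rewrite -scaleN1r Nseminorm.2 normrN1 mul1r. Qed.

Lemma seminorm0 : N 0 = 0.
Proof. by rewrite -[X in N X](scale0r (0 : V)) Nseminorm.2 normr0 mul0r. Qed.

Lemma seminorm_ge0 x : 0 <= N x.
Proof. by have := Nseminorm.1 x (- x); rewrite subrr seminorm0 seminormN; lra. Qed.

Lemma dist_to_le x d : D d -> dist_to N D x <= N (x - d).
Proof.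
move=> Dd; apply: ge_inf; last by exists d.
by exists 0 => _ [e _ <-]; exact: seminorm_ge0.
Qed.

Lemma dist_to_ge0 x : 0 <= dist_to N D x.
Proof.
apply: lb_le_inf; first by exists (N (x - 0)); exists 0; [exact: Dsub.1|].
by move=> _ [e _ <-]; exact: seminorm_ge0.
Qed.

(** The distance need not be attained. *)
Lemma dist_to_approx x e : 0 < e -> exists2 d, D d & N (x - d) < dist_to N D x + e.
Proof.
move=> e0; have [|_ [d Dd <-] Nd] := @inf_adherent _ [set N (x - d) | d in D] _ e0.
  split; first by exists (N (x - 0)); exists 0; [exact: Dsub.1|].
  by exists 0 => _ [d _ <-]; exact: seminorm_ge0.
by exists d.
Qed.

Lemma dist_to_le_seminorm x : dist_to N D x <= N x.
Proof. by have := dist_to_le x Dsub.1; rewrite subr0. Qed.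

Lemma dist_to_mem d : D d -> dist_to N D d = 0.
Proof.
move=> Dd; apply/eqP; rewrite eq_le dist_to_ge0 andbT.
by have := dist_to_le d Dd; rewrite subrr seminorm0.
Qed.

Lemma dist_to_add x y : dist_to N D (x + y) <= dist_to N D x + dist_to N D y.
Proof.
apply/ler_addgt0Pr => e e0; have e2 : 0 < e / 2 by lra.
have [a Da xa] := dist_to_approx x e2; have [b Db yb] := dist_to_approx y e2.
have Dab : D (a + b) by have := Dsub.2 1 _ _ Da Db; rewrite rmorph1 scale1r.
apply: le_trans (dist_to_le _ Dab) _.
have := Nseminorm.1 (x - a) (y - b); rewrite addrACA -opprD; lra.
Qed.

(** Real homogeneity survives although [D] is stable under rational scalars
    only, because a real multiple of a vector is a limit of rational ones. *)
Lemma dist_to_scale_le t x : dist_to N D (t *: x) <= `|t| * dist_to N D x.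
Proof.
apply/ler_addgt0Pr => e e0.
(* [d] is close to [x] and [q] to [t], each contributing at most [e / 2]; the [+ 1] keeps the
   denominators nonzero when [t] or [N d] vanishes. *)
have c0 : 0 < e / (2 * (`|t| + 1)).
  by rewrite divr_gt0// mulr_gt0// ltr_wpDl.
have [d Dd xd] := dist_to_approx x c0.
have Nd0 := seminorm_ge0 d.
have c1 : 0 < e / (2 * (N d + 1)) by rewrite divr_gt0// mulr_gt0// ltr_wpDl.
have [q] : exists q, ratr q \in `]t - e / (2 * (N d + 1)), t + e / (2 * (N d + 1))[.
  by apply: rat_in_itvoo; lra.
rewrite in_itv /= => /andP[q1 q2].
have Dq : D (ratr q *: d) by have := Dsub.2 q _ _ Dd Dsub.1; rewrite addr0.
apply: le_trans (dist_to_le _ Dq) _.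
have -> : t *: x - ratr q *: d = t *: (x - d) + (t - ratr q) *: d.
  by rewrite scalerBr scalerBl addrA subrK.
apply: le_trans (Nseminorm.1 _ _) _; rewrite !Nseminorm.2.
have qt : `|t - ratr q| * N d <= e / 2.
  apply: (@le_trans _ _ (e / (2 * (N d + 1)) * N d)).
    by rewrite ler_wpM2r// ler_norml; apply/andP; split; lra.
  have -> : e / (2 * (N d + 1)) * N d = e / 2 * (N d / (N d + 1)).
    by field; rewrite gt_eqF// ltr_wpDl.
  rewrite ler_piMr//; first lra.
  by rewrite ler_pdivrMr ?mul1r; [lra|rewrite ltr_wpDl].
have td : `|t| * N (x - d) <= `|t| * dist_to N D x + e / 2.
  apply: (@le_trans _ _ (`|t| * (dist_to N D x + e / (2 * (`|t| + 1))))).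
    by rewrite ler_wpM2l// ltW.
  rewrite mulrDr lerD2l.
  have -> : `|t| * (e / (2 * (`|t| + 1))) = e / 2 * (`|t| / (`|t| + 1)).
    by field; rewrite gt_eqF// ltr_wpDl.
  rewrite ler_piMr//; first lra.
  by rewrite ler_pdivrMr ?mul1r; [lra|rewrite ltr_wpDl].
lra.
Qed.

Lemma dist_to_seminorm : seminorm (dist_to N D).
Proof.
split=> [|t x]; first exact: dist_to_add.
apply/eqP; rewrite eq_le dist_to_scale_le /=.
have [->|t0] := eqVneq t 0; first by rewrite normr0 mul0r dist_to_ge0.
have n0 : 0 < `|t| by rewrite normr_gt0.
by have := dist_to_scale_le t^-1 (t *: x); rewrite scalerK// normfV ler_pdivlMl.
Qed.

End distance.

(** Rational polynomials serve as a countable type of finitely supported coefficient sequences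
    that comes with its linear structure. *)
Definition rational_comb (u : nat -> V) (P : {poly rat}) : V :=
  \sum_(i < size P) ratr P`_i *: u i.

Lemma rational_comb_widen u (P : {poly rat}) n : (size P <= n)%N ->
  rational_comb u P = \sum_(i < n) ratr P`_i *: u i.
Proof.
move=> Pn; rewrite /rational_comb (big_ord_widen n (fun i => ratr P`_i *: u i))//.
rewrite big_mkcond; apply: eq_bigr => i _; case: ltnP => // Pi.
by rewrite nth_default// rmorph0 scale0r.
Qed.

Lemma rational_combX u i : rational_comb u 'X^i = u i.
Proof.
rewrite /rational_comb size_polyXn big_ord_recr /= coefXn eqxx rmorph1 scale1r.
rewrite big1 ?add0r// => j _.
by rewrite coefXn ltn_eqF// rmorph0 scale0r.
Qed.

Lemma rational_comb_subspace u : rational_subspace (range (rational_comb u)).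
Proof.
split; first by exists 0; rewrite // /rational_comb size_poly0 big_ord0.
move=> q _ _ [P _ <-] [Q _ <-]; exists (q *: P + Q) => //.
pose n := maxn (size P) (size Q).
have Pn : (size P <= n)%N by rewrite leq_maxl.
have Qn : (size Q <= n)%N by rewrite leq_maxr.
rewrite (rational_comb_widen u Pn) (rational_comb_widen u Qn).
rewrite (@rational_comb_widen u _ n); last first.
  rewrite (leq_trans (size_polyD _ _))// geq_max Qn andbT.
  exact: leq_trans (size_scale_leq _ _) Pn.
rewrite scaler_sumr -big_split /=; apply: eq_bigr => i _.
by rewrite coefD coefZ rmorphD rmorphM scalerDl scalerA.
Qed.

End RationalSpan.

(** * Real and complex scalars *)

Section Scalars.
Context {R : realType} {s : scalars}.
Local Notation K := (scalar_field R s).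

Definition of_real : R -> K :=
  match s return R -> scalar_field R s with
  | RealScalars => fun r : R => r
  | ComplexScalars => fun r : R => (r%:C)%C
  end.

Lemma real_part_of_real r : real_part (of_real r) = r.
Proof. by rewrite /real_part /of_real; case: s. Qed.

Lemma of_realD : {morph of_real : x y / x + y}.
Proof. by rewrite /of_real; case: s => // x y; rewrite rmorphD. Qed.

Lemma of_realM : {morph of_real : x y / x * y}.
Proof. by rewrite /of_real; case: s => // x y; rewrite rmorphM. Qed.

Lemma of_real1 : of_real 1 = 1.
Proof. by rewrite /of_real; case: s. Qed.

Lemma of_real0 : of_real 0 = 0.
Proof. by rewrite /of_real; case: s. Qed.

Lemma of_real_le x y : (of_real x <= of_real y) = (x <= y).
Proof. by rewrite /of_real; case: s => //; rewrite lecR. Qed.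

Lemma of_real_lt x y : (of_real x < of_real y) = (x < y).
Proof. by rewrite /of_real; case: s => //; rewrite ltcR. Qed.

Lemma of_real_norm x : `|of_real x| = of_real `|x|.
Proof. by rewrite /of_real; case: s => //=; rewrite normc_def /= expr0n addr0 sqrtr_sqr. Qed.

Lemma real_part_ge0K (z : K) : 0 <= z -> of_real (real_part z) = z.
Proof.
rewrite /of_real /real_part; move: z; case: s => //= -[a b].
by rewrite lecE /= => /andP[/eqP -> _].
Qed.

Lemma real_partD : {morph (@real_part R s) : x y / x + y}.
Proof. by rewrite /real_part; case: s => // -[a b] [c d]. Qed.

Lemma real_partN : {morph (@real_part R s) : x / - x}.
Proof. by rewrite /real_part; case: s => // -[a b]. Qed.

Lemma real_partZ t z : real_part (of_real t * z) = t * real_part z.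
Proof. by move: z; rewrite /real_part /of_real; case: s => // -[a b] /=; rewrite mul0r subr0. Qed.

Section rnorm.
Context {V : normedModType K}.
Implicit Types x y : V.

Lemma of_real_rnorm x : of_real (rnorm x) = `|x|.
Proof. exact/real_part_ge0K. Qed.

Lemma rnorm_ge0 x : 0 <= rnorm x.
Proof. by rewrite -of_real_le of_real_rnorm of_real0. Qed.

Lemma rnormD x y : rnorm (x + y) <= rnorm x + rnorm y.
Proof. by rewrite -of_real_le of_realD !of_real_rnorm ler_normD. Qed.

Lemma rnormN x : rnorm (- x) = rnorm x.
Proof. by rewrite /rnorm normrN. Qed.

Lemma rnorm_sub x y : rnorm (x - y) = rnorm (y - x).
Proof. by rewrite /rnorm distrC. Qed.

Lemma rnorm0 : rnorm (0 : V) = 0.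
Proof. by rewrite /rnorm normr0 -of_real0 real_part_of_real. Qed.

Lemma rnorm_eq0 x : (rnorm x == 0) = (x == 0).
Proof.
apply/idP/idP => [/eqP x0|/eqP ->]; last by rewrite rnorm0.
by rewrite -normr_eq0 -of_real_rnorm x0 of_real0.
Qed.

Lemma rnorm_of_realZ t x : rnorm (of_real t *: x) = `|t| * rnorm x.
Proof. by rewrite {1}/rnorm normrZ of_real_norm real_partZ. Qed.

End rnorm.

Lemma rnormZ (V : normedModType K) (a : K^o) (x : V) :
  rnorm (a *: x) = rnorm a * rnorm x.
Proof. by rewrite {1}/rnorm normrZ -(of_real_rnorm (a : K^o)) real_partZ. Qed.

Lemma real_part_le_rnorm (z : K^o) : `|real_part z| <= rnorm z.
Proof.
rewrite /rnorm /real_part; move: z; case: s => //= -[a b] /=.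
by rewrite -[leLHS]sqrtr_sqr ler_sqrt ?addr_ge0 ?sqr_ge0// lerDl sqr_ge0.
Qed.

(** [X] with its scalars restricted to [R]. *)
Definition realified (X : normedModType K) : Type := X.

HB.instance Definition _ (X : normedModType K) := GRing.Zmodule.copy (realified X) X.

Section realified.
Variable X : normedModType K.
Implicit Types (t r : R) (x y : X).

Let scale t (x : realified X) : realified X := of_real t *: (x : X).

Let scaleA t r x : scale t (scale r x) = scale (t * r) x.
Proof. by rewrite /scale scalerA of_realM. Qed.

Let scale1 : left_id 1 scale.
Proof. by move=> x; rewrite /scale of_real1 scale1r. Qed.

Let scaleDr : right_distributive scale +%R.
Proof. by move=> t x y; rewrite /scale scalerDr. Qed.

Let scaleDl x : {morph scale^~ x : t r / t + r}.
Proof. by move=> t r; rewrite /scale of_realD scalerDl. Qed.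

HB.instance Definition _ :=
  GRing.Zmodule_isLmodule.Build R (realified X) scaleA scale1 scaleDr scaleDl.

Lemma realified_scaleE t (x : realified X) : t *: x = of_real t *: (x : X) :> X.
Proof. by []. Qed.

Lemma rnorm_seminorm : seminorm (fun x : realified X => rnorm (x : X)).
Proof.
by split=> [x y|t x]; [exact: rnormD|rewrite realified_scaleE rnorm_of_realZ].
Qed.

End realified.

(** Norms take their values in the scalar field; this puts convergence in terms of real norms. *)
Lemma cvg_rnormP (V : normedModType K) T (F : set_system T) (a : T -> V) (l : V) :
  Filter F ->
  (a @ F --> l) <-> (forall e, 0 < e -> \forall n \near F, rnorm (a n - l) < e).
Proof.
move=> FF; split=> [/cvgrPdist_lt al e e0|al].
  have := al (of_real e); rewrite -{1}of_real0 of_real_lt => /(_ e0).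
  by apply: filterS => n; rewrite -of_real_rnorm of_real_lt rnorm_sub.
apply/cvgrPdist_lt => e e0.
have eE := real_part_ge0K (ltW e0).
have : 0 < real_part e by rewrite -of_real_lt of_real0 eE.
move=> /al; apply: filterS => n.
by rewrite -{2}eE -of_real_rnorm of_real_lt rnorm_sub.
Qed.

End Scalars.

Definition imag_part {R : realType} {s : scalars} : scalar_field R s -> R :=
  match s return scalar_field R s -> R with
  | RealScalars => fun=> 0
  | ComplexScalars => fun z : R[i] => complex.Im z
  end.

Lemma imag_part_le_rnorm {R : realType} {s : scalars} (z : (scalar_field R s)^o) :
  `|imag_part z| <= rnorm z.
Proof.
rewrite /rnorm /imag_part /real_part; move: z; case: s => //= [z|[a b]].
  by rewrite normr0.
by rewrite -[leLHS]sqrtr_sqr ler_sqrt ?addr_ge0 ?sqr_ge0// lerDr sqr_ge0.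
Qed.

Lemma rnorm_le_parts {R : realType} {s : scalars} (z : (scalar_field R s)^o) :
  rnorm z <= `|real_part z| + `|imag_part z|.
Proof.
rewrite /rnorm /imag_part /real_part; move: z; case: s => //= [z|[a b]].
  by rewrite normr0 addr0.
rewrite /= -[leRHS]ger0_norm ?addr_ge0// -[leRHS]sqrtr_sqr ler_sqrt ?sqr_ge0//.
rewrite sqrrD !real_normK ?num_real// lerD2r lerDl.
by rewrite mulrn_wge0// mulr_ge0.
Qed.

(** In the complex case a bounded real-linear [h] is the real part of
    [x |-> h x - i h (i x)]. *)
Lemma dual_of_real_linear (R : realType) (s : scalars)
    (X : normedModType (scalar_field R s)) (h : realified X -> R) :
  (forall t x y, h (t *: x + y) = t * h x + h y) -> (forall x, h x <= rnorm (x : X)) ->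
  exists2 f, dual X f & forall x, real_part (f x) = h x.
Proof.
move=> hl hb.
have h0 : h 0 = 0 by have := hl (-1) 0 0; rewrite scaler0 addr0; lra.
have hN x : h (- x) = - h x by have := hl (-1) x 0; rewrite scaleN1r h0 !addr0 mulN1r.
have {hb h0} hb (x : X) : `|h x| <= rnorm x.
  by rewrite ler_norml hb andbT; have := hb (- x); rewrite hN rnormN; lra.
case: s X h hl hN hb => X h hl hN hb.
  exists h => //; split; first exact: hl.
  by exists 1 => x; rewrite mul1r; exact: hb.
pose f (x : X) : R[i]^o := (h x -i* h ('i%C *: x))%C.
exists f => //; split.
- move=> [a b] x y.
  have aE (z : X) : (a +i* b)%C *: z =
      @of_real R ComplexScalars a *: z + @of_real R ComplexScalars b *: ('i%C *: z).
    rewrite scalerA -scalerDl; congr (_ *: _).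
    by apply/eqP; rewrite eq_complex /=; simpc; rewrite ?eqxx.
  have ii (z : X) : 'i%C *: ('i%C *: z) = - z.
    by rewrite scalerA -expr2 sqr_i scaleN1r.
  have ha (z w : X) : h ((a +i* b)%C *: z + w) = a * h z + b * h ('i%C *: z) + h w.
    by rewrite aE -addrA -addrA -(hl b) -hl.
  have ia : ('i%C : R[i]) * (a +i* b)%C = (a +i* b)%C * 'i%C by rewrite mulrC.
  rewrite /f scalerDr scalerA ia -scalerA !ha ii hN.
  apply/eqP; rewrite eq_complex /=; apply/andP; split; apply/eqP; ring.
- exists 2 => x; apply: le_trans (@rnorm_le_parts R ComplexScalars (f x)) _.
  rewrite /= normrN.
  have : rnorm ('i%C *: x) = rnorm x.
    by rewrite rnormZ /rnorm /= expr0n expr1n add0r sqrtr1 mul1r.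
  have := hb x; have := hb ('i%C *: x); lra.
Qed.

(** Both uses of Hahn-Banach: with [p] the norm, a functional norming [x0]; with [p] the distance
    to a subspace, a functional that vanishes on the subspace and detects the points outside its
    closure. Only the real part is controlled by [p], which need not be a seminorm over the
    complex scalars. *)
Lemma supporting_functional (R : realType) (s : scalars)
    (X : normedModType (scalar_field R s)) (p : realified X -> R) (x0 : X) :
  seminorm p -> (forall x, p x <= rnorm (x : X)) ->
  exists f, [/\ dual X f, forall x, real_part (f x) <= p x & real_part (f x0) = p x0].
Proof.
move=> [pD pZ] pN.
have ps : sublinear p by split=> // t x t0; rewrite pZ ger0_norm.
have [h [hl hp h0]] := hahn_banach (x0 : realified X) ps.
have [x|f fd fh] := dual_of_real_linear hl; first exact: le_trans (hp x) (pN x).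
by exists f; split=> // [x|]; rewrite fh.
Qed.

(** * Bounded operators *)

Section BoundedOperators.
Context {R : realType} {s : scalars} {X Y : normedModType (scalar_field R s)}.
Context (T : X -> Y) (bT : bounded_operators X Y T).

Lemma bounded_operatorZ a x : T (a *: x) = a *: T x.
Proof.
have [+ _] := bT => /(_ a x 0); rewrite addr0 => ->.
suff -> : T 0 = 0 by rewrite addr0.
by have := bT.1 (-1) 0 0; rewrite scaler0 addr0 scaleN1r addNr.
Qed.

Lemma bounded_operatorD x y : T (x + y) = T x + T y.
Proof. by have := bT.1 1 x y; rewrite !scale1r. Qed.

Lemma bounded_operatorB x y : T (x - y) = T x - T y.
Proof. by rewrite bounded_operatorD -scaleN1r bounded_operatorZ scaleN1r. Qed.

Lemma bounded_operator0 : T 0 = 0.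
Proof. by rewrite -(subrr 0) bounded_operatorB subrr. Qed.

Lemma opnorm_ge x : rnorm x <= 1 -> rnorm (T x) <= opnorm T.
Proof.
move=> x1; apply: ub_le_sup; last by exists x.
have [_ [M TM]] := bT; exists `|M| => _ [z z1 <-].
apply: le_trans (TM z) _; apply: le_trans (ler_norm _) _.
by rewrite normrM (ger0_norm (rnorm_ge0 z)) ler_piMr.
Qed.

Lemma opnorm_ge0 : 0 <= opnorm T.
Proof.
by have := @opnorm_ge 0; rewrite bounded_operator0 !rnorm0; apply; exact: ler01.
Qed.

Lemma opnormP x : rnorm (T x) <= opnorm T * rnorm x.
Proof.
have [->|x0] := eqVneq x 0; first by rewrite bounded_operator0 !rnorm0 mulr0.
have nx : 0 < rnorm x by rewrite lt_neqAle rnorm_ge0 eq_sym rnorm_eq0 x0.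
have := @opnorm_ge (of_real (rnorm x)^-1 *: x).
rewrite bounded_operatorZ !rnorm_of_realZ gtr0_norm ?invr_gt0// mulVf ?gt_eqF//.
by move=> /(_ (lexx _)); rewrite mulrC ler_pdivrMr.
Qed.

End BoundedOperators.

(** * Weak sequential compactness of balls in reflexive spaces *)

Lemma rnorm_lim_le {R : realType} {s : scalars} (V : normedModType (scalar_field R s))
    T (F : set_system T) (a : T -> V) (l : V) (c : R) :
  ProperFilter F -> a @ F --> l -> (forall n, rnorm (a n) <= c) -> rnorm l <= c.
Proof.
move=> FF /cvg_rnormP al ac; apply/ler_addgt0Pr => e e0.
have [n] := filter_ex (al e e0); rewrite rnorm_sub.
by have := rnormD (l - a n) (a n); rewrite subrK; have := ac n; lra.
Qed.

(** A cluster point given by compactness is a limit, because an ultrafilter contains the preimage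
    of a neighbourhood or the preimage of its complement. *)
Lemma real_ultralimit {R : realType} T (U : set_system T) (a : T -> R) (M : R) :
  UltraFilter U -> (forall n, `|a n| <= M) -> exists l : R, a @ U --> l.
Proof.
move=> UU aM.
have aI : (a @ U) [set` `[- M, M]].
  by apply: (@filterE _ U) => n /=; rewrite in_itv /=; have := aM n; rewrite ler_norml.
have [l [_ al]] := @segment_compact R (- M) M (a @ U) _ aI.
exists l => A Al; have [//|UA] := in_ultra_setVsetC (a @^-1` A) UU.
have [z [nAz Az]] := al (~` A) A UA Al.
by [].
Qed.

Lemma ultralimit {R : realType} {s : scalars} T (U : set_system T)
    (a : T -> (scalar_field R s)^o) (M : R) :
  UltraFilter U -> (forall n, rnorm (a n) <= M) -> exists l : (scalar_field R s)^o, a @ U --> l.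
Proof.
move=> UU aM.
have [l1 al1] := real_ultralimit UU (fun n => le_trans (real_part_le_rnorm (a n)) (aM n)).
have [l2 al2] := real_ultralimit UU (fun n => le_trans (imag_part_le_rnorm (a n)) (aM n)).
have [l [lE1 lE2]] : exists l : (scalar_field R s)^o, real_part l = l1 /\ imag_part l = l2.
  clear aM; case: s a al1 al2 => a al1 al2; last by exists (l1 +i* l2)%C.
  exists l1; split=> //=; rewrite -(cvg_lim (@Rhausdorff R) al2).
  by apply/esym/(cvg_lim (@Rhausdorff R)); exact: cvg_cst.
exists l; apply/cvg_rnormP => e e0; have e2 : 0 < e / 2 by lra.
move/cvgrPdist_lt: al1 => /(_ _ e2) al1; move/cvgrPdist_lt: al2 => /(_ _ e2) al2.
apply: filterS2 al1 al2 => n; rewrite -lE1 -lE2 => n1 n2.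
apply: le_lt_trans (rnorm_le_parts _) _.
have ipD (x y : scalar_field R s) : imag_part (x - y) = imag_part x - imag_part y.
  rewrite /imag_part; clear; move: x y; case: s => [x y|[? ?] [? ?]] //=.
  by rewrite subr0.
rewrite real_partD real_partN ipD -[X in X + _]normrN -[X in _ + X]normrN !opprB.
lra.
Qed.

(** The limits along an ultrafilter of the values of functionals on a bounded family form an
    element of the bidual, and reflexivity represents it by a vector. *)
Lemma reflexive_ultralimit {R : realType} {s : scalars}
    (X : normedModType (scalar_field R s)) T (U : set_system T) (u : T -> X) (M : R) :
  reflexive_space X -> UltraFilter U -> (forall n, rnorm (u n) <= M) ->
  exists x, forall f, dual X f -> f (u n) @[n --> U] --> f x.
Proof.
move=> Xr UU uM.
have dcvg f : exists l : (scalar_field R s)^o, dual X f -> f (u n) @[n --> U] --> l.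
  have [df|ndf] := pselect (dual X f); last by exists 0.
  have [l fl] : exists l : (scalar_field R s)^o, f (u n) @[n --> U] --> l; last by exists l.
  apply: (@ultralimit _ _ _ _ _ (opnorm f * M)) => n.
  apply: le_trans (opnormP df _) _.
  by rewrite ler_wpM2l// (opnorm_ge0 df).
have [phi phiP] := choice dcvg.
have [|x xphi] := Xr phi; last by exists x => f df; rewrite -xphi//; exact: phiP.
split.
- move=> a f g df dg.
  have dafg : dual X (a *: f + g).
    have fgE z : (a *: f + g) z = a *: f z + g z by [].
    split.
      move=> b x y; rewrite !fgE df.1 dg.1 !scalerDr addrACA; congr (_ + _ + _).
      by rewrite !scalerA mulrC.
    exists (rnorm (a : (scalar_field R s)^o) * opnorm f + opnorm g) => x; rewrite fgE.
    apply: le_trans (rnormD _ _) _; rewrite mulrDl lerD ?(opnormP dg)//.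
    by rewrite rnormZ -mulrA ler_wpM2l ?rnorm_ge0 ?(opnormP df).
  have hK := @norm_hausdorff _ ((scalar_field R s)^o : normedModType (scalar_field R s)).
  rewrite -(cvg_lim hK (phiP _ dafg)); apply: (cvg_lim hK).
  apply: cvgD; last exact: phiP.
  by apply: cvgZ; [exact: cvg_cst|exact: phiP].
- exists M => f df; apply: rnorm_lim_le (phiP f df) _ => n.
  apply: le_trans (opnormP df _) _.
  by rewrite mulrC ler_wpM2r// (opnorm_ge0 df).
Qed.

(** A functional supporting the distance to the span vanishes on the span, so its limit does too:
    this is the weak closedness of norm-closed subspaces. *)
Lemma weak_limit_dist0 {R : realType} {s : scalars}
    (X : normedModType (scalar_field R s)) T (U : set_system T) (u : T -> X) (x : X)
    (D : set (realified X)) :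
  ProperFilter U -> rational_subspace D -> (forall n, D (u n)) ->
  (forall f, dual X f -> f (u n) @[n --> U] --> f x) ->
  dist_to (fun z : realified X => rnorm (z : X)) D x = 0.
Proof.
move=> UU sD Du ux; set N := fun z : realified X => _.
have sN : seminorm N by exact: rnorm_seminorm.
have [f [df fp fx]] := supporting_functional x (dist_to_seminorm sN sD)
  (dist_to_le_seminorm sN sD).
apply/eqP; rewrite eq_le (dist_to_ge0 sN sD) andbT leNgt; apply/negP => d0.
have /cvg_rnormP /(_ _ d0) /filter_ex [n] := ux f df; apply/negP; rewrite -leNgt.
have := fp (u n); rewrite (dist_to_mem sN sD (Du n)) => fn.
rewrite rnorm_sub; apply: le_trans (le_trans (ler_norm _) (real_part_le_rnorm _)).
by rewrite real_partD real_partN fx; lra.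
Qed.

Definition weakly_converges {R : realType} {s : scalars} {X : normedModType (scalar_field R s)}
    (u : nat -> X) (x : X) : Prop :=
  forall f, dual X f -> f (u n) @[n --> \oo] --> f x.

(** Functionals [g d] that norm the points [d] of [D] separate the points of its closure: if [d] is
    close to [z] then [|d| = Re (g d d) = Re (g d (d - z)) <= |d - z|], so [d], and with it [z], is
    close to [0]. *)
Lemma eq0_of_norming {R : realType} {s : scalars} (X : normedModType (scalar_field R s))
    (D : set (realified X)) (g : X -> (X -> (scalar_field R s)^o)) (z : X) :
  rational_subspace D ->
  (forall d, D d -> [/\ dual X (g d), forall x, real_part (g d x) <= rnorm x &
    real_part (g d d) = rnorm (d : X)]) ->
  dist_to (fun x : realified X => rnorm (x : X)) D z = 0 ->
  (forall d, D d -> g d z = 0) -> z = 0.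
Proof.
move=> sD gP z0 gz; apply/eqP; rewrite -rnorm_eq0 eq_le rnorm_ge0 andbT.
apply/ler_addgt0Pr => e e0; have e2 : 0 < e / 2 by lra.
have [d Dd] := dist_to_approx (rnorm_seminorm X) sD z e2.
rewrite z0 !add0r => zd; have [dg gle gd] := gP d Dd.
have := gle (d - z); rewrite (bounded_operatorB dg) gz// subr0 gd => dz.
have := rnormD (z - d) d; rewrite subrK (rnorm_sub z d).
have : rnorm (d - z) < e / 2 by rewrite rnorm_sub; exact: zd.
lra.
Qed.

(** The sequential compactness half of the Eberlein-Smulian theorem. The index function [sigma]
    need not be increasing: [k <= sigma k] is enough for [u \o sigma] to inherit the limits of
    [u]. *)
Lemma reflexive_weak_subsequence {R : realType} {s : scalars}
    (X : normedModType (scalar_field R s)) (u : nat -> X) (M : R) :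
  reflexive_space X -> (forall n, rnorm (u n) <= M) ->
  exists (sigma : nat -> nat) (x : X),
    (forall k, (k <= sigma k)%N) /\ weakly_converges (u \o sigma) x.
Proof.
move=> Xr uM.
have [U [UU ooU]] := ultraFilterLemma eventually_filter.
have [x ux] := reflexive_ultralimit Xr UU uM.
pose c (P : {poly rat}) : realified X := rational_comb (u : nat -> realified X) P.
pose N (z : realified X) := rnorm (z : X).
have sN : seminorm N by exact: rnorm_seminorm.
have [g gP] := choice (fun d : X => supporting_functional d sN (fun z => lexx _)).
have dg d : dual X (g d) by have [] := gP d.
pose G k := if unpickle k is Some P then g (c P) else g 0.
have dG k : dual X (G k) by rewrite /G; case: unpickle => *; exact: dg.
(* The [j]-th norming functional is taken into account from rank [j] on. *)
have sigmaP k : exists n, (k <= n)%N /\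
    forall j : 'I_k.+1, rnorm (G j (u n) - G j x) < k.+1%:R^-1.
  have k0 : 0 < k.+1%:R^-1 :> R by rewrite invr_gt0 ltr0n.
  have Uk : U [set n | (k <= n)%N] by apply: ooU; exact: nbhs_infty_ge.
  have UG : \forall n \near U, forall j : 'I_k.+1, rnorm (G j (u n) - G j x) < k.+1%:R^-1.
    by apply: filter_forall => j; have /cvg_rnormP := ux _ (dG j); exact.
  by have [n [kn nG]] := filter_ex (filterI Uk UG); exists n.
have [sigma sigmaE] := choice sigmaP.
exists sigma, x; split=> [k|f df]; first by have [] := sigmaE k.
have gx P : forall e, 0 < e ->
    \forall k \near \oo, rnorm (g (c P) (u (sigma k)) - g (c P) x) < e.
  move=> _/posnumP[e]; near=> k.
  have Pk : (pickle P < k.+1)%N by rewrite ltnS; near: k; exact: nbhs_infty_ge.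
  have [_ /(_ (Ordinal Pk))] := sigmaE k; rewrite /G /= pickleK => /lt_trans; apply.
  by near: k; exact: near_infty_natSinv_lt.
(* Otherwise a further subsequence [w] stays away from [x] on [f], hence so does its limit [y]. *)
apply/cvg_rnormP => e e0; apply: contrapT => nfx.
have tauP N0 : exists n, (N0 <= n)%N /\ e <= rnorm (f (u (sigma n)) - f x).
  apply: contrapT => nN; apply: nfx; near=> n; rewrite ltNge; apply/negP => en.
  by apply: nN; exists n; split=> //; near: n; exact: nbhs_infty_ge.
have [tau tauE] := choice tauP.
pose w := u \o sigma \o tau.
have [y wy] : exists y, forall h, dual X h -> h (w n) @[n --> U] --> h y.
  by apply: (@reflexive_ultralimit _ _ _ _ _ _ M) => // n; exact: uM.
have sD := rational_comb_subspace (u : nat -> realified X).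
have Du n : range (rational_comb (u : nat -> realified X)) (u n).
  by exists 'X^n => //; rewrite rational_combX.
have x0 : dist_to N (range c) x = 0 by exact: weak_limit_dist0 ux.
have y0 : dist_to N (range c) y = 0.
  by apply: weak_limit_dist0 wy => // n; exact: Du.
have yx : y - x = 0.
  apply: (eq0_of_norming (g := g) sD) => [d _||_ [P _ <-]].
  - exact: gP.
  - apply/eqP; rewrite eq_le (dist_to_ge0 sN sD) andbT.
    have := dist_to_add sN sD y (- x : realified X).
    by rewrite (seminormN (dist_to_seminorm sN sD)) x0 y0 addr0.
  - rewrite (bounded_operatorB (dg _)); apply/eqP.
    rewrite -rnorm_eq0 eq_le rnorm_ge0 andbT; apply/ler_addgt0Pr => d d0.
    have d2 : 0 < d / 2 by lra.
    have /cvg_rnormP /(_ _ d2) Uy := wy _ (dg (c P)).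
    have Ux : \forall n \near U, rnorm (g (c P) (w n) - g (c P) x) < d / 2.
      have [m _ mx] := gx P _ d2; apply: ooU; exists m => // n /= mn.
      by apply: mx => /=; apply: leq_trans mn _; have [] := tauE n.
    have [n [ny nx]] := filter_ex (filterI Uy Ux).
    have := rnormD (g (c P) y - g (c P) (w n)) (g (c P) (w n) - g (c P) x).
    by rewrite addrA subrK (rnorm_sub (g (c P) y) (g (c P) (w n))); lra.
have {}yx : y = x by apply/eqP; rewrite -subr_eq0 yx.
have /cvg_rnormP /(_ _ e0) /filter_ex [n] := wy f df.
by rewrite yx ltNge; apply/negP; rewrite negbK; have [] := tauE n.
Unshelve. all: by end_near. Qed.

(** * The weak maximizing property *)

Lemma not_weakly_nullP {R : realType} {s : scalars} (X : normedModType (scalar_field R s))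
    (u : nat -> X) : ~ weakly_null u ->
  exists f, dual X f /\ exists2 e, 0 < e & forall N, exists n, (N <= n)%N /\ e <= rnorm (f (u n)).
Proof.
move=> nu; apply: contrapT => nf; apply: nu => f df; apply/cvg_rnormP => e e0.
apply: contrapT => nfe; apply: nf; exists f; split=> //; exists e => // N.
apply: contrapT => nN; apply: nfe; near=> n; rewrite subr0 ltNge; apply/negP => en.
by apply: nN; exists n; split=> //; near: n; exact: nbhs_infty_ge.
Unshelve. all: by end_near. Qed.

Lemma limn_esup_le_bound {R : realType} (a : nat -> \bar R) (c : \bar R) :
  (forall n, a n <= c)%E -> (limn_esup a <= c)%E.
Proof.
move=> ac; apply: le_trans (_ : ereal_sup (range a) <= c)%E.
  by apply: ereal_inf_lbound; exists setT => //; exact: filterT.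
by apply: ge_ereal_sup => _ [n _ <-].
Qed.

Lemma limn_esup_EFin {R : realType} (a : nat -> R) (l : R) :
  a @ \oo --> l -> limn_esup (fun n => (a n)%:E) = l%:E.
Proof.
move=> al; apply: (cvg_limn_einf_sup _).2.
by apply: cvg_comp al _; exact: cvg_id.
Qed.

Lemma cvg_subsequence {T : topologicalType} (a : nat -> T) (l : T) (sigma : nat -> nat) :
  (forall k, (k <= sigma k)%N) -> a @ \oo --> l -> a \o sigma @ \oo --> l.
Proof.
move=> ks al A Al; have [N _ NA] := al _ Al.
by exists N => // n /= Nn; apply: NA => /=; exact: leq_trans Nn (ks n).
Qed.

Section Maximizing.
Context {R : realType} {s : scalars} {X Y : normedModType (scalar_field R s)}.
Context (T : X -> Y) (bT : bounded_operators X Y T).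

Lemma attains_norm_of_ge x : x != 0 -> opnorm T * rnorm x <= rnorm (T x) -> attains_norm T.
Proof.
move=> x0 Tx; have nx : 0 < rnorm x by rewrite lt_neqAle rnorm_ge0 eq_sym rnorm_eq0 x0.
have x1 : rnorm (of_real (rnorm x)^-1 *: x) = 1.
  by rewrite rnorm_of_realZ gtr0_norm ?invr_gt0// mulVf ?gt_eqF.
exists (of_real (rnorm x)^-1 *: x) => //; apply/eqP; rewrite eq_le.
rewrite (opnorm_ge bT) ?x1//=.
by rewrite (bounded_operatorZ bT) rnorm_of_realZ gtr0_norm ?invr_gt0// mulrC ler_pdivlMr.
Qed.

Lemma op_contraction_scale : 0 < opnorm T ->
  op_contraction (fun x => of_real (opnorm T)^-1 *: T x).
Proof.
move=> T0; split; first split.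
- by move=> a x y; rewrite bT.1 scalerDr !scalerA mulrC.
- exists 1 => x; rewrite rnorm_of_realZ gtr0_norm ?invr_gt0// mul1r.
  by rewrite mulrC ler_pdivrMr// mulrC; exact: opnormP.
- apply: ge_sup.
    by exists (rnorm (of_real (opnorm T)^-1 *: T 0)); exists 0 => //=; rewrite rnorm0.
  move=> _ [x x1 <-]; rewrite rnorm_of_realZ gtr0_norm ?invr_gt0//.
  by rewrite mulrC ler_pdivrMr// mul1r; exact: (opnorm_ge bT).
Qed.

(** If the limit did not satisfy [|T x| >= |T| |x|], property strict (M) applied to [T / |T|], [x]
    and the weakly null sequence [u n - x] would give [1 < limsup |u n| <= 1]. *)
Lemma weak_limit_maximizing (u : nat -> X) (x : X) :
  pair_strictM X Y -> 0 < opnorm T -> maximizing_sequence T u -> weakly_converges u x ->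
  opnorm T * rnorm x <= rnorm (T x).
Proof.
move=> hM T0 [u1 uT] ux; rewrite leNgt; apply/negP => Tx.
pose S x := of_real (opnorm T)^-1 *: T x.
have Sx z : rnorm (S z) = (opnorm T)^-1 * rnorm (T z).
  by rewrite rnorm_of_realZ gtr0_norm ?invr_gt0.
have nullux : weakly_null (fun n => u n - x).
  move=> f df; apply/cvg_rnormP => e e0.
  have /cvg_rnormP := ux f df => /(_ e e0); apply: filterS => n.
  by rewrite (bounded_operatorB df) subr0.
have SSx : rnorm (S x) < rnorm x by rewrite Sx mulrC ltr_pdivrMr// mulrC.
have := hM _ (op_contraction_scale T0) x (S x) SSx _ nullux.
apply/negP; rewrite -leNgt.
under eq_fun do rewrite addrC subrK.
apply: (@le_trans _ _ 1%E); first by apply: limn_esup_le_bound => n; rewrite lee_fin.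
rewrite (_ : (fun n => _) = fun n => ((opnorm T)^-1 * rnorm (T (u n)))%:E).
  rewrite (@limn_esup_EFin _ _ 1)//.
  rewrite -[X in _ --> X](mulVf (lt0r_neq0 T0)).
  by apply: cvgM; [exact: cvg_cst|exact: uT].
apply/funext => n; congr (_%:E); rewrite -Sx; congr rnorm.
by rewrite /S -scalerDr (bounded_operatorB bT) addrC subrK.
Qed.

End Maximizing.

Theorem theorem3p1 (R : realType) (s : scalars)
    (X Y : completeNormedModType (scalar_field R s))
    (hX : reflexive_space X) (hM : pair_strictM X Y) :
  pair_WMP X Y.
Proof.
move=> T bT [u [u1 uT] /not_weakly_nullP [f [df [e e0 ufe]]]].
have nz z : e <= rnorm (f z) -> z != 0.
  by apply: contraTneq => ->; rewrite (bounded_operator0 df) rnorm0 -ltNge.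
have [T0|T0] : 0 < opnorm T \/ opnorm T = 0.
  by move: (opnorm_ge0 bT); rewrite le_eqVlt => /orP[/eqP|]; [right|left].
- have [tau tauE] := choice ufe.
  have [sigma [x [sigma_ge vx]]] : exists (sigma : nat -> nat) (x : X),
      (forall k, (k <= sigma k)%N) /\ weakly_converges ((u \o tau) \o sigma) x.
    by apply: (@reflexive_weak_subsequence _ _ _ _ 1) => // n; exact: u1.
  have x0 : x != 0.
    apply/eqP => x0; have /cvg_rnormP /(_ e e0) /filter_ex [n] := vx f df.
    rewrite x0 (bounded_operator0 df) subr0; apply/negP; rewrite -leNgt.
    by have [] := tauE (sigma n).
  apply: (attains_norm_of_ge bT x0); apply: weak_limit_maximizing hM T0 _ vx => //.
  split=> [n|]; first exact: u1.
  apply: (@cvg_subsequence _ (fun n => rnorm (T (u n))) _ (tau \o sigma)) uT => k /=.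
  by apply: leq_trans (sigma_ge k) _; have [] := tauE (sigma k).
(* [T] is zero, and attains its norm at any nonzero vector. *)
- have [n [_ /nz un0]] := ufe 0%N.
  by apply: (attains_norm_of_ge bT un0); rewrite T0 mul0r rnorm_ge0.
Qed.
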